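(* Let $\epsilon_1>0$ be a constant such that for all integers $d\ge 0$, $n\ge d+1$ and all $h:\mathbb{F}_2^n\to\mathbb{F}_2$ one has $\Pr[T_{\mathrm{GN}}^h\text{ rejects}]\ge\min\{2^d\delta_d(h),\epsilon_1\}$. Then for all integers $d\ge 0$, $n\ge 1$, $t\ge 1$ and every $f:\mathbb{F}_2^n\to\mathbb{F}_2$, $$\delta_d(f^{\oplus t})\ \ge\ \frac{1-\left(1-2\min\{\epsilon_1/4,\ 2^{d-2}\cdot\delta_d(f)\}\right)^{t/2^d}}{2}.$$ In particular, if $\delta_d(f)\ge 0.1$, then $\delta_d(f^{\oplus t})\ge \frac12-2^{-\Omega(t/2^d)}$, where the implied constant in $\Omega$ is a positive constant independent of $d,n,t,f$.
   Context: Every function $f:\mathbb{F}_2^n\to\mathbb{F}_2$ is uniquely a multilinear polynomial over $\mathbb{F}_2$; $\deg f$ is its degree. $\delta_d(f)=\min\{\Pr_{x\in\mathbb{F}_2^n}[f(x)\ne g(x)] : g:\mathbb{F}_2^n\to\mathbb{F}_2,\ \deg g\le d\}$, with $x$ uniform. The test $T_{\mathrm{GN}}^h$ (with degree parameter $d$) picks a uniformly random $(d+1)$-dimensional affine subspace $A\subseteq\mathbb{F}_2^n$ and accepts if and only if $h|_A$ (viewed as a function on $\mathbb{F}_2^{d+1}$ through any affine parametrization of $A$) has degree at most $d$; otherwise it rejects. A constant $\epsilon_1$ with the stated property exists (it is a theorem of the same paper). For $f:\mathbb{F}_2^n\to\mathbb{F}_2$, the $t$-wise XOR $f^{\oplus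 t}:(\mathbb{F}_2^n)^t\to\mathbb{F}_2$ is $f^{\oplus t}(x_1,\dots,x_t)=\sum_{i=1}^t f(x_i)$; it is a function on $\mathbb{F}_2^{nt}$, and $\delta_d(f^{\oplus t})$ is its distance to polynomials of degree at most $d$ in $nt$ variables. *)

(* Defs.v *)
From mathcomp Require Import all_boot all_order all_algebra.
From mathcomp Require Import mpoly.

Set Implicit Arguments.
Unset Strict Implicit.
Unset Printing Implicit Defensive.

Import Order.TTheory GRing.Theory Num.Theory.
Local Open Scope ring_scope.

Definition multilinear (n : nat) (p : {mpoly 'F_2[n]}) : bool :=
  all (fun m : 'X_{1..n} => [forall i, (m i <= 1)%N]) (msupp p).

Definition meval_row (n : nat) (p : {mpoly 'F_2[n]}) (x : 'rV['F_2]_n) : 'F_2 :=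
  p.@[fun i => x 0 i].

(* The factor 'X_i + a_i + 1 is the indicator of x_i = a_i over F_2.  By
   [mlpolyP], [mlpoly f] is the only multilinear polynomial representing f. *)
Definition mlpoly (n : nat) (f : 'rV['F_2]_n -> 'F_2) : {mpoly 'F_2[n]} :=
  \sum_(a : 'rV['F_2]_n) f a *: \prod_(i < n) ('X_i + (a 0 i + 1)%:MP).

(* [msize] is one more than the total degree; the zero function has degree 0. *)
Definition deg (n : nat) (f : 'rV['F_2]_n -> 'F_2) : nat := (msize (mlpoly f)).-1.

Lemma F2_cases (x : 'F_2) : x = 0 \/ x = 1.
Proof.
case: x => [[|[|m]] hm]; last by [].
- by left; apply: val_inj.
- by right; apply: val_inj.
Qed.

Lemma mlpoly_eval (n : nat) (f : 'rV['F_2]_n -> 'F_2) (x : 'rV['F_2]_n) :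
  meval_row (mlpoly f) x = f x.
Proof.
rewrite /meval_row /mlpoly raddf_sum /= (bigD1 x) //= mevalZ rmorph_prod /=.
rewrite big1 => [|i _]; last first.
  by rewrite mevalD mevalXU mevalC; case: (F2_cases (x 0 i)) => ->; apply: val_inj.
rewrite mulr1 big1 ?addr0 // => a neq.
have [i hi] : exists i, a 0 i != x 0 i.
  apply/existsP; rewrite -negb_forall; apply: contra neq => /forallP h.
  by apply/eqP/rowP => i; apply/eqP.
rewrite mevalZ rmorph_prod (bigD1 i) //= mevalD mevalXU mevalC.
suff -> : x 0 i + (a 0 i + 1) = 0 by rewrite mul0r mulr0.
by move: hi; case: (F2_cases (x 0 i)) => ->; case: (F2_cases (a 0 i)) => -> //= _;
   apply: val_inj.
Qed.

Lemma mlpoly_multilinear (n : nat) (f : 'rV['F_2]_n -> 'F_2) :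
  multilinear (mlpoly f).
Proof.
apply/allP => m; rewrite mcoeff_msupp; apply: contraR => /forallPn [i hi].
rewrite /mlpoly raddf_sum /= big1 // => a _.
rewrite mcoeffZ (bigD1 i) //=; set q := \prod_(_ | _) _.
suff -> : (('X_i + (a 0 i + 1)%:MP) * q)@_m = 0 by rewrite mulr0.
have qP : forall m', m' \in msupp q -> m' i = 0%N.
  rewrite /q; elim/big_ind: _ => [m'|p1 p2 h1 h2 m'|j ji m'].
  - by rewrite msupp1 inE => /eqP ->; rewrite mnm0E.
  - move/msuppM_le => /allpairsP [[m1 m2] /= [/h1 e1 /h2 e2 ->]].
    by rewrite mnmDE e1 e2.
  - move/msuppD_le; rewrite mem_cat msuppX inE => /orP [/eqP ->|].
      by rewrite mnm1E (negbTE ji).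
    by rewrite msuppC; case: ifP => // _; rewrite inE => /eqP ->; rewrite mnm0E.
apply/eqP; rewrite mcoeff_eq0; apply: contra hi.
move/msuppM_le => /allpairsP [[m1 m2] /= [h1 /qP e2 ->]].
rewrite mnmDE e2 addn0.
move/msuppD_le: h1; rewrite mem_cat msuppX inE => /orP [/eqP ->|].
  by rewrite mnm1E eqxx.
by rewrite msuppC; case: ifP => // _; rewrite inE => /eqP ->; rewrite mnm0E.
Qed.

Lemma multilinear_eq0 (n : nat) (p : {mpoly 'F_2[n]}) :
  multilinear p -> (forall x, meval_row p x = 0) -> p = 0.
Proof.
move=> /allP mlp p0; apply/eqP/negPn/negP => pn0.
have [m0 m0p] : exists m, m \in msupp p.
  by exists (mlead p); apply: mlead_supp.
have hex : exists k, has (fun m : 'X_{1..n} => mdeg m == k) (msupp p).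
  by exists (mdeg m0); apply/hasP; exists m0.
case: (ex_minnP hex) => k /hasP [m mp /eqP mk] kmin.
have := p0 (\row_i (m i)%:R); rewrite /meval_row mevalE.
rewrite (bigD1_seq m) ?msupp_uniq //= [X in _ + X]big1_seq => [|m' /andP [m'm m'p]].
  rewrite addr0 big1 ?mulr1 => [/eqP|i _]; first by rewrite mcoeff_eq0 mp.
  rewrite mxE; have := forallP (mlp _ mp) i.
  by case: (m i) => [|[|]] //; rewrite ?expr0 ?expr1.
have [i /andP [mi0 mi1]] : exists i, (m i == 0%N) && (m' i != 0%N).
  apply/existsP; apply: contraR m'm; rewrite negb_exists => /forallP h.
  have le i : (m' i <= m i)%N.
    have := h i; have := forallP (mlp _ m'p) i.
    by case: (m i) (m' i) => [|a] [|[|b]].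
  have mm' : (mdeg m <= mdeg m')%N.
    by rewrite mk; apply: kmin; apply/hasP; exists m'.
  have /mnm_lepP le' : (forall i, m' i <= m i)%N := le.
  have : (mdeg (m - m')%MM + mdeg m' = mdeg m)%N by rewrite -mdegD submK.
  move=> e; have : mdeg (m - m')%MM == 0%N.
    by rewrite -leqn0 -(leq_add2r (mdeg m')) e.
  by rewrite mdeg_eq0 => /eqP e0; rewrite -(submK le') e0 add0m.
rewrite (bigD1 i) //= mxE (eqP mi0) expr0n (negbTE mi1) mul0r mulr0 //.
Qed.

Lemma mlpolyP (n : nat) (f : 'rV['F_2]_n -> 'F_2) (p : {mpoly 'F_2[n]}) :
  (multilinear p /\ forall x, meval_row p x = f x) <-> p = mlpoly f.
Proof.
split=> [[mlp pf]|->]; last by split; [apply: mlpoly_multilinear|apply: mlpoly_eval].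
apply/eqP; rewrite -subr_eq0; apply/eqP; apply: multilinear_eq0.
  apply/allP => m /msuppB_le; rewrite mem_cat => /orP [] hm.
    exact: (allP mlp).
  exact: (allP (mlpoly_multilinear f)).
by move=> x; rewrite /meval_row mevalB -!/(meval_row _ x) pf mlpoly_eval subrr.
Qed.

Definition prob (R : numFieldType) (T : finType) (S : {set T}) (P : pred T) : R :=
  #|[set x in S | P x]|%:R / #|S|%:R.

(* The default value 1 never matters: it bounds every probability from above,
   and g = 0 always qualifies. *)
Definition delta (R : realFieldType) (d n : nat) (f : 'rV['F_2]_n -> 'F_2) : R :=
  \big[Num.min/1]_(g : {ffun 'rV['F_2]_n -> 'F_2} | (deg g <= d)%N)
     prob R [set: 'rV['F_2]_n] (fun x => f x != g x).

Definition affine_map (k n : nat) (v : 'rV['F_2]_n) (M : 'M['F_2]_(k, n))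
    (u : 'rV['F_2]_k) : 'rV['F_2]_n := v + u *m M.

Definition parametrizes (k n : nat) (v : 'rV['F_2]_n) (M : 'M['F_2]_(k, n))
    (A : {set 'rV['F_2]_n}) : bool :=
  row_free M && (A == [set affine_map v M u | u : 'rV['F_2]_k]).

Definition affine_subspaces (k n : nat) : {set {set 'rV['F_2]_n}} :=
  [set A | [exists v, exists M : 'M['F_2]_(k, n), parametrizes v M A]].

(* The degree is invariant under invertible affine changes of variables, so all
   parametrizations of A give the same answer. *)
Definition gn_accepts (d n : nat) (h : 'rV['F_2]_n -> 'F_2)
    (A : {set 'rV['F_2]_n}) : bool :=
  [forall v, forall M : 'M['F_2]_(d.+1, n), parametrizes v M A ==>
     (deg (fun u => h (affine_map v M u)) <= d)%N].

Definition gn_reject_prob (R : numFieldType) (d n : nat)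
    (h : 'rV['F_2]_n -> 'F_2) : R :=
  prob R (affine_subspaces d.+1 n) (fun A => ~~ gn_accepts d h A).

(* A point of (F_2^n)^t is a vector of length t * n, cut by [vec_mx] into t
   consecutive blocks of length n. *)
Definition xor_power (t n : nat) (f : 'rV['F_2]_n -> 'F_2)
    (x : 'rV['F_2]_(t * n)) : 'F_2 :=
  \sum_(i < t) f (row i (vec_mx x)).

(* Main.v *)
Require Import Defs.
From mathcomp Require Import all_boot all_order all_algebra.
From mathcomp Require Import all_classical all_reals all_analysis.
From mathcomp Require Import ring lra.
From mathcomp Require Import -(notations) mpoly.

(* Let [phase] be a |-> (-1)^a and [gowers k F] the average over x, y_1, ..., y_k of
   the product of F over the cube spanned at x by the y_i.  Repeated Cauchy-Schwarz
   gives (E F)^(2^(d+1)) <= gowers (d+1) F.  Multiplying F by the phase of a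
   polynomial of degree <= d does not change gowers (d+1) F, and gowers is
   multiplicative over independent blocks, so the correlation of the t-wise XOR of f
   with degree d is at most (1 - 2 rho)^(t/2^(d+1)), where rho is the probability that
   f sums to 1 on a random, possibly degenerate, (d+1)-dimensional cube.  A
   nondegenerate cube is a uniform parametrized affine subspace, on which that sum
   vanishes exactly when the degree is at most d.  With
   m = min(eps1/4, 2^(d-2) delta), this yields rho >= 2 m, hence
   1 - 2 rho <= (1 - 2 m)^2; the square is what turns the exponent t/2^(d+1) into
   t/2^d. *)

Set Implicit Arguments.
Unset Strict Implicit.
Unset Printing Implicit Defensive.

Import Order.TTheory GRing.Theory Num.Theory.
Local Open Scope ring_scope.

(** * Averages over finite types *)

Definition mean (R : numFieldType) (T : finType) (F : T -> R) : R :=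
  (\sum_x F x) / #|T|%:R.

Lemma eq_mean (R : numFieldType) (T : finType) (F G : T -> R) :
  F =1 G -> mean F = mean G.
Proof. by move=> FG; rewrite /mean (eq_bigr _ (fun x _ => FG x)). Qed.

Lemma le_mean (R : numFieldType) (T : finType) (F G : T -> R) :
  (forall x, F x <= G x) -> mean F <= mean G.
Proof.
move=> FG; rewrite /mean ler_wpM2r ?invr_ge0 ?ler0n //.
exact: ler_sum.
Qed.

Lemma mean_bij (R : numFieldType) (T T' : finType) (h : T' -> T) (F : T -> R) :
  bijective h -> mean F = mean (F \o h).
Proof.
move=> bij_h; rewrite /mean (reindex h) ?(bij_eq_card bij_h) //.
exact: onW_bij.
Qed.

Lemma meanZ (R : numFieldType) (T : finType) (c : R) (F : T -> R) :
  mean (fun x => c * F x) = c * mean F.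
Proof. by rewrite /mean -mulr_sumr mulrA. Qed.

Lemma mean_unique (R : numFieldType) (T : finType) (x0 : T) (F : T -> R) :
  (forall x, x = x0) -> mean F = F x0.
Proof.
move=> T1; rewrite (@eq_mean _ _ _ (fun=> F x0)) => [|x]; last by rewrite (T1 x).
rewrite /mean sumr_const -[_ *+ #|_|]mulr_natr mulfK // pnatr_eq0 -lt0n.
by apply/card_gt0P; exists x0.
Qed.

Lemma addr_bij (V : zmodType) (a : V) : bijective (+%R a).
Proof. by exists (+%R (- a)) => x; rewrite ?addKr ?addNKr. Qed.

Lemma mean_pair (R : numFieldType) (T1 T2 : finType) (F : T1 -> T2 -> R) :
  mean (fun x => mean (F x)) = mean (fun p : T1 * T2 => F p.1 p.2).
Proof.
rewrite /mean card_prod natrM -(pair_bigA _ F) /= invfM -mulr_suml.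
by rewrite -mulrA [X in _ * X]mulrC.
Qed.

Lemma exchange_mean (R : numFieldType) (T1 T2 : finType) (F : T1 -> T2 -> R) :
  mean (fun x => mean (F x)) = mean (fun y => mean (F^~ y)).
Proof.
rewrite /mean -!mulr_suml exchange_big /= -!mulrA; congr (_ * _); exact: mulrC.
Qed.

Lemma mean_prod (R : numFieldType) (I T : finType) (F : I -> T -> R) :
  mean (fun x : {ffun I -> T} => \prod_i F i (x i)) = \prod_i mean (F i).
Proof.
rewrite /mean -bigA_distr_bigA big_split /= prodr_const card_ffun natrX.
by rewrite exprVn.
Qed.

(** Nonnegativity of the variance. An empty [T] is treated apart: both means are then 0, since
    dividing by 0 gives 0. *)
Lemma sqr_mean_le (R : numFieldType) (T : finType) (F : T -> R) :
  (forall x, F x \is Num.real) -> mean F ^+ 2 <= mean (fun x => F x ^+ 2).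
Proof.
move=> Fr; have [T0|T_gt0] := posnP #|T|.
  by rewrite /mean T0 invr0 !mulr0 expr0n.
set m := mean F; have mr : m \is Num.real.
  by rewrite /m /mean realM ?realV ?realn // rpred_sum // => i _; apply: Fr.
have T0 : #|T|%:R != 0 :> R by rewrite pnatr_eq0 -lt0n.
have : 0 <= mean (fun x => (F x - m) ^+ 2).
  rewrite /mean divr_ge0 ?ler0n // sumr_ge0 // => i _.
  by rewrite real_exprn_even_ge0 ?realB.
suff -> : mean (fun x => (F x - m) ^+ 2) = mean (fun x => F x ^+ 2) - m ^+ 2.
  by rewrite subr_ge0.
have sF : \sum_x F x = m * #|T|%:R by rewrite mulfVK.
rewrite /mean (eq_bigr (fun x => F x ^+ 2 + - (m *+ 2) * F x + m ^+ 2)).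
  by rewrite !big_split /= -mulr_sumr sumr_const -[_ *+ #|_|]mulr_natr sF; field.
by move=> i _; ring.
Qed.

(** * Gowers averages and Cauchy-Schwarz *)

Definition mderiv (R : numFieldType) (V : zmodType) (F : V -> R) (y x : V) : R :=
  F x * F (x + y).

(* The [2 ^ k]-th power of the Gowers [U^k] norm. *)
Fixpoint gowers (R : numFieldType) (V : finZmodType) (k : nat) (F : V -> R) : R :=
  if k is k'.+1 then mean (fun y => gowers k' (mderiv F y)) else mean F.

Lemma eq_gowers (R : numFieldType) (V : finZmodType) (k : nat) (F G : V -> R) :
  F =1 G -> gowers k F = gowers k G.
Proof.
elim: k F G => [|k IHk] F G FG /=; first exact: eq_mean.
by apply: eq_mean => y; apply: IHk => x; rewrite /mderiv !FG.
Qed.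

(** For fixed x the point x + y is uniform, so averaging [F (x + y)] over y gives [mean F] whatever
    x is. *)
Lemma gowers1 (R : numFieldType) (V : finZmodType) (F : V -> R) :
  gowers 1 F = gowers 0 F ^+ 2.
Proof.
rewrite /= exchange_mean expr2 -meanZ; apply: eq_mean => x.
rewrite mulrC -meanZ [RHS](mean_bij _ (addr_bij x)); exact: eq_mean.
Qed.

(** [gowers k.+1 F] is an average over the first direction y, so [sqr_mean_le] moves the square
    inside that average, where the induction hypothesis applies to [mderiv F y]. *)
Lemma gowers_monotone (R : realFieldType) (V : finZmodType) (k : nat) (F : V -> R) :
  gowers k F ^+ 2 <= gowers k.+1 F.
Proof.
elim: k F => [|k IHk] F; first by rewrite gowers1.
apply: le_trans (sqr_mean_le _) (le_mean _) => y; first exact: num_real.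
exact: IHk.
Qed.

Lemma mean_exp_le_gowers (R : realFieldType) (V : finZmodType) (k : nat)
    (F : V -> R) : mean F ^+ (2 ^ k.+1) <= gowers k.+1 F.
Proof.
elim: k => [|k IHk]; first by rewrite gowers1.
rewrite expnSr exprM; apply: le_trans (gowers_monotone _ _).
(* Squaring the induction hypothesis needs its left side to be nonnegative. This holds because the
   exponent [2 ^ k.+1] is even, whatever the sign of [mean F]. *)
by rewrite lerXn2r ?nnegrE ?(le_trans _ IHk) // exprn_even_ge0 // oddX.
Qed.

Lemma gowersS_ge0 (R : realFieldType) (V : finZmodType) (k : nat) (F : V -> R) :
  0 <= gowers k.+1 F.
Proof. exact: le_trans (sqr_ge0 _) (gowers_monotone _ _). Qed.

(** * Independent blocks and cubes *)

Definition blocks (K : finNzRingType) (t n : nat) (x : 'rV[K]_(t * n)) :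
  {ffun 'I_t -> 'rV[K]_n} := [ffun i => row i (vec_mx x)].

Lemma blocks_bij (K : finNzRingType) (t n : nat) : bijective (@blocks K t n).
Proof.
exists (fun x : {ffun 'I_t -> 'rV[K]_n} => mxvec (\matrix_i x i)) => x.
  apply: (can_inj vec_mxK); rewrite mxvecK; apply/row_matrixP => i.
  by rewrite rowK ffunE.
by apply/ffunP => i; rewrite ffunE mxvecK rowK.
Qed.

Lemma mean_blocks (R : numFieldType) (K : finNzRingType) (t n : nat)
    (F : 'I_t -> 'rV[K]_n -> R) :
  mean (fun x : 'rV[K]_(t * n) => \prod_i F i (row i (vec_mx x)))
  = \prod_i mean (F i).
Proof.
rewrite -mean_prod [RHS](mean_bij _ (blocks_bij K t n)); apply: eq_mean => x /=.
by apply: eq_bigr => i _; rewrite ffunE.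
Qed.

(** A derivative in direction y acts on block i in direction [row i (vec_mx y)], and these
    directions are independent. Since they differ between blocks, the induction needs a family [F i]
    and not a single function. *)
Lemma gowers_blocks (R : numFieldType) (K : finNzRingType) (t n k : nat)
    (F : 'I_t -> 'rV[K]_n -> R) :
  gowers k (fun x : 'rV[K]_(t * n) => \prod_i F i (row i (vec_mx x)))
  = \prod_i gowers k (F i).
Proof.
elim: k F => [|k IHk] F /=; first exact: mean_blocks.
rewrite -mean_blocks; apply: eq_mean => y; rewrite -IHk; apply: eq_gowers => x.
by rewrite /mderiv -big_split; apply: eq_bigr => i _; rewrite !raddfD.
Qed.

Lemma prod_rV_F2 (R : comPzRingType) (k : nat) (P : 'rV['F_2]_(1 + k) -> R) :
  \prod_u P u =
  \prod_(u : 'rV['F_2]_k) (P (row_mx 0 u) * P (row_mx (const_mx 1) u)).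
Proof.
rewrite (reindex (fun p : 'F_2 * 'rV['F_2]_k => row_mx (const_mx p.1) p.2)) /=.
  rewrite -(pair_bigA _ (fun b u => P (row_mx (const_mx b) u))) /=.
  rewrite !big_ord_recl big_ord0 mulr1 -big_split /=; apply: eq_bigr => u _.
  by congr (P (row_mx _ u) * P (row_mx _ u)); apply/matrixP => i j; rewrite !mxE;
     apply: val_inj.
apply: onW_bij.
exists (fun u : 'rV['F_2]_(1 + k) => (lsubmx u 0 0, rsubmx u)) => [[b u]|u] /=.
  by rewrite row_mxKl row_mxKr mxE.
by rewrite -[RHS]hsubmxK; congr row_mx; apply/rowP => j; rewrite mxE !ord1.
Qed.

Lemma col_mx_bij (K : Type) (m1 m2 n : nat) :
  bijective (fun p : 'M[K]_(m1, n) * 'M[K]_(m2, n) => col_mx p.1 p.2).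
Proof.
exists (fun M => (usubmx M, dsubmx M)) => [[A B]|M] /=; last exact: vsubmxK.
by rewrite col_mxKu col_mxKd.
Qed.

(** Unrolling the recursion: the rows of M are the successive directions, and u selects which of
    them are added to v. The product over u splits along its first coordinate, matching one
    [mderiv]. *)
Lemma gowers_cube (R : numFieldType) (n k : nat) (F : 'rV['F_2]_n -> R) :
  gowers k F = mean (fun M : 'M['F_2]_(k, n) => mean (fun v =>
    \prod_(u : 'rV['F_2]_k) F (affine_map v M u))).
Proof.
elim: k F => [|k IHk] F /=.
  rewrite [RHS](@mean_unique _ _ 0) => [|M]; last exact: flatmx0.
  apply: eq_mean => v; rewrite (bigD1 0) //= big1 ?mulr1 => [|u].
    by rewrite /affine_map mulmx0 addr0.
  by rewrite [u]thinmx0 eqxx.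
rewrite [RHS](mean_bij _ (col_mx_bij _ 1 k n)) /=.
under eq_mean => y do rewrite IHk.
rewrite mean_pair; apply: eq_mean => -[y M] /=; apply: eq_mean => v.
rewrite prod_rV_F2; apply: eq_bigr => u _.
have split_cube (b : 'rV['F_2]_1) :
    affine_map v (col_mx y M : 'M['F_2]_(k.+1, n)) (row_mx b u : 'rV['F_2]_k.+1) =
    v + (b *m y + u *m M).
  by rewrite -mul_row_col.
rewrite !split_cube /mderiv mul0mx add0r; congr (F _ * F _).
rewrite -addrA; congr (_ + _); rewrite addrC; congr (_ + _).
by apply/rowP => j; rewrite mxE big_ord1 !mxE mul1r.
Qed.

(** * Iterated derivatives of polynomials over F_2 *)

Definition aderiv (V : zmodType) (g : V -> 'F_2) (y x : V) : 'F_2 := g x + g (x + y).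

(** With k = d + 1 this is the form of degree at most d that can be followed through the recursion
    of [gowers]. *)
Fixpoint derivs_vanish (V : zmodType) (k : nat) (g : V -> 'F_2) : Prop :=
  if k is k'.+1 then forall y, derivs_vanish k' (aderiv g y) else g =1 (fun=> 0).

Lemma eq_derivs_vanish (V : zmodType) (k : nat) (g h : V -> 'F_2) :
  g =1 h -> derivs_vanish k g -> derivs_vanish k h.
Proof.
elim: k g h => [|k IHk] g h gh /= vg; first by move=> x; rewrite -gh vg.
by move=> y; apply: IHk (vg y) => x; rewrite /aderiv !gh.
Qed.

Lemma derivs_vanishD (V : zmodType) (k : nat) (g h : V -> 'F_2) :
  derivs_vanish k g -> derivs_vanish k h -> derivs_vanish k (fun x => g x + h x).
Proof.
elim: k g h => [|k IHk] g h /= vg vh; first by move=> x; rewrite vg vh addr0.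
by move=> y; apply: eq_derivs_vanish (IHk _ _ (vg y) (vh y)) => x; rewrite /aderiv addrACA.
Qed.

Lemma derivs_vanish0 (V : zmodType) (k : nat) :
  derivs_vanish k (fun _ : V => 0).
Proof.
elim: k => //= k IHk y; apply: eq_derivs_vanish IHk => x.
by rewrite /aderiv addr0.
Qed.

Lemma derivs_vanishZ (V : zmodType) (k : nat) (a : 'F_2) (g : V -> 'F_2) :
  derivs_vanish k g -> derivs_vanish k (fun x => a * g x).
Proof.
elim: k g => [|k IHk] g /= vg; first by move=> x; rewrite vg mulr0.
by move=> y; apply: eq_derivs_vanish (IHk _ (vg y)) => x; rewrite /aderiv mulrDr.
Qed.

Lemma derivs_vanishS (V : zmodType) (k : nat) (g : V -> 'F_2) :
  derivs_vanish k g -> derivs_vanish k.+1 g.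
Proof.
elim: k g => [|k IHk] g vg y; last by apply: (IHk (aderiv g y)); apply: vg.
by move=> x; rewrite /aderiv !vg addr0.
Qed.

Lemma derivs_vanish_leq (V : zmodType) (j k : nat) (g : V -> 'F_2) :
  (j <= k)%N -> derivs_vanish j g -> derivs_vanish k g.
Proof.
by move=> /subnK <- vg; elim: (_ - _)%N => // i; apply: derivs_vanishS.
Qed.

Lemma derivs_vanish_sum (V : zmodType) (k : nat) (I : Type) (r : seq I)
    (g : I -> V -> 'F_2) :
  (forall i, derivs_vanish k (g i)) -> derivs_vanish k (fun x => \sum_(i <- r) g i x).
Proof.
move=> vg; elim: r => [|i r IHr].
  by apply: eq_derivs_vanish (derivs_vanish0 _ k) => x; rewrite big_nil.
by apply: eq_derivs_vanish (derivs_vanishD (vg i) IHr) => x; rewrite big_cons.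
Qed.

(* Leibniz rule: D_y (x_i g) = y_i g + y_i D_y g + x_i D_y g. *)
Lemma derivs_vanish_coord (n k : nat) (i : 'I_n) (g : 'rV['F_2]_n -> 'F_2) :
  derivs_vanish k g -> derivs_vanish k.+1 (fun x : 'rV['F_2]_n => x 0 i * g x).
Proof.
elim: k g => [|k IHk] g vg y; first by move=> x; rewrite /aderiv !vg !mulr0 addr0.
have vy := IHk _ (vg y).
apply: eq_derivs_vanish (derivs_vanishD (derivs_vanishZ (y 0 i) vg)
  (derivs_vanishD (derivs_vanishZ (y 0 i) (derivs_vanishS (vg y))) vy)) => x.
rewrite /aderiv mxE !mulrDr !mulrDl.
by case: (F2_cases (x 0 i)) => ->; case: (F2_cases (y 0 i)) => ->;
   case: (F2_cases (g x)) => ->; case: (F2_cases (g (x + y))) => ->; apply: val_inj.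
Qed.

Lemma derivs_vanish_monomial (n : nat) (m : 'I_n -> nat) :
  derivs_vanish (\sum_i m i).+1 (fun x : 'rV['F_2]_n => \prod_i x 0 i ^+ m i).
Proof.
(* Generalized to a list of variables, so that the monomial is built one coordinate factor at a
   time, each raising the order by one. *)
have gen (r : seq 'I_n) : derivs_vanish (\sum_(i <- r) m i).+1
    (fun x : 'rV['F_2]_n => \prod_(i <- r) x 0 i ^+ m i).
  elim: r => [|i r IHr].
    by rewrite big_nil => y x; rewrite /aderiv !big_nil; apply: val_inj.
  have pow e : derivs_vanish (e + \sum_(j <- r) m j).+1
      (fun x : 'rV['F_2]_n => x 0 i ^+ e * \prod_(j <- r) x 0 j ^+ m j).
    elim: e => [|e IHe].
      by apply: eq_derivs_vanish IHr => x; rewrite expr0 mul1r.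
    apply: eq_derivs_vanish (derivs_vanish_coord i IHe) => x.
    by rewrite exprS mulrA.
  rewrite big_cons; apply: eq_derivs_vanish (pow (m i)) => x.
  by rewrite big_cons.
exact: gen.
Qed.

Lemma deg_derivs_vanish (n d : nat) (g : 'rV['F_2]_n -> 'F_2) :
  (deg g <= d)%N -> derivs_vanish d.+1 g.
Proof.
rewrite /deg; set p := mlpoly g => pd.
(* [derivs_vanish_sum] asks for the vanishing of every summand, but the degree bound covers only
   monomials of the support; the [if] makes the other summands zero. *)
have vp : derivs_vanish d.+1 (fun x : 'rV['F_2]_n => \sum_(m <- mpoly.msupp p)
    (if m \in mpoly.msupp p then mpoly.mcoeff m p * \prod_i x 0 i ^+ m i else 0)).
  apply: derivs_vanish_sum => m; case mp: (m \in _); last exact: derivs_vanish0.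
  apply: derivs_vanishZ; apply: derivs_vanish_leq _ (derivs_vanish_monomial m).
  rewrite ltnS -mpoly.mdegE; move/mpoly.msize_mdeg_lt: mp.
  by case: (mpoly.mmeasure _ p) pd => //= e ed; rewrite ltnS => /leq_trans; apply.
apply: eq_derivs_vanish vp => x.
rewrite -[RHS]mlpoly_eval /meval_row mpoly.mevalE big_seq [RHS]big_seq.
by apply: eq_bigr => m ->.
Qed.

(** * Phases and their invariance *)

Definition phase (R : numFieldType) (a : 'F_2) : R := if a == 0 then 1 else -1.

Lemma phaseD (R : numFieldType) (a b : 'F_2) :
  phase R (a + b) = phase R a * phase R b.
Proof.
rewrite /phase.
by case: (F2_cases a) => ->; case: (F2_cases b) => -> /=; rewrite ?mulr1 ?mul1r ?mulrNN ?mulr1.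
Qed.

Lemma phase_sum (R : numFieldType) (I : Type) (r : seq I) (g : I -> 'F_2) :
  phase R (\sum_(i <- r) g i) = \prod_(i <- r) phase R (g i).
Proof. exact: (big_morph _ (@phaseD R)). Qed.

Lemma phaseE (R : numFieldType) (a : 'F_2) : phase R a = 1 - 2 * (a != 0)%:R.
Proof. by rewrite /phase; case: eqP => _ /=; ring. Qed.

(** Each derivative of the product is a derivative of F times the phase of the additive derivative
    of g. After k of them the phase is constantly 1. *)
Lemma gowers_phase (R : numFieldType) (V : finZmodType) (k : nat) (F : V -> R)
    (g : V -> 'F_2) :
  derivs_vanish k g -> gowers k (fun x => F x * phase R (g x)) = gowers k F.
Proof.
elim: k F g => [|k IHk] F g vg /=; apply: eq_mean => x.
  by rewrite vg /phase eqxx mulr1.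
rewrite -[RHS](IHk _ _ (vg x)); apply: eq_gowers => y.
by rewrite /mderiv /aderiv phaseD mulrACA.
Qed.

(** * Degree and the sum of all values *)

Lemma sum_F2_pow (e : nat) : \sum_(a : 'F_2) a ^+ e = (e != 0%N)%:R.
Proof.
have -> : \sum_(a : 'F_2) a ^+ e = 0 ^+ e + 1 ^+ e.
  rewrite !big_ord_recl big_ord0 addr0.
  by congr (_ ^+ e + _ ^+ e); apply: val_inj.
by rewrite expr1n expr0n; case: e => [|e]; apply: val_inj.
Qed.

Lemma sum_prod_rV (K : finComNzRingType) (n : nat) (h : 'I_n -> K -> K) :
  \sum_(x : 'rV[K]_n) \prod_i h i (x 0 i) = \prod_i \sum_a h i a.
Proof.
rewrite bigA_distr_bigA (reindex (fun x : 'rV[K]_n => [ffun i => x 0 i])) /=.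
  by apply: eq_bigr => x _; apply: eq_bigr => i _; rewrite ffunE.
apply: onW_bij; exists (fun x : {ffun 'I_n -> K} => \row_i x i) => x.
  by apply/rowP => i; rewrite mxE ffunE.
by apply/ffunP => i; rewrite ffunE mxE.
Qed.

(** The sum of a monomial factors over the coordinates. A variable with exponent 0 contributes 1 + 1
    = 0, so only monomials containing every variable survive. *)
Lemma sum_mlpoly (n : nat) (g : 'rV['F_2]_n -> 'F_2) :
  \sum_x g x = \sum_(m <- mpoly.msupp (mlpoly g))
    mpoly.mcoeff m (mlpoly g) * [forall i, m i != 0%N]%:R.
Proof.
under eq_bigr => x _ do rewrite -mlpoly_eval /meval_row mpoly.mevalE.
rewrite exchange_big /=; apply: eq_bigr => m _; rewrite -mulr_sumr; congr (_ * _).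
rewrite (sum_prod_rV (fun i a => a ^+ m i)); under eq_bigr do rewrite sum_F2_pow.
case: forallP => [m1|/forallP]; first by rewrite big1 // => i _; rewrite m1.
by rewrite negb_forall => /existsP [i /negPn /eqP mi]; rewrite (bigD1 i) //= mi mul0r.
Qed.

Lemma deg_leP (n d : nat) (g : 'rV['F_2]_n -> 'F_2) :
  reflect {in mpoly.msupp (mlpoly g), forall m, (mpoly.mdeg m <= d)%N} (deg g <= d)%N.
Proof.
rewrite /deg mpoly.mmeasureE -subn1 leq_subLR add1n.
apply: (iffP (bigmax_leqP_seq _ _ _ _)) => mP m mS; first exact: mP.
by move=> _; apply: mP.
Qed.

Lemma deg_leq_dim (n : nat) (g : 'rV['F_2]_n -> 'F_2) : (deg g <= n)%N.
Proof.
apply/deg_leP => m mS; rewrite mpoly.mdegE -[leqRHS]card_ord -sum1_card.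
by apply: leq_sum => i _; apply: (forallP (allP (mlpoly_multilinear g) m mS)).
Qed.

(** In d + 1 variables the only multilinear monomial of degree above d is the product of all
    variables, and by [sum_mlpoly] its coefficient is the sum of g. *)
Lemma deg_leq_sum0 (d : nat) (g : 'rV['F_2]_d.+1 -> 'F_2) :
  (deg g <= d)%N = (\sum_x g x == 0).
Proof.
have full m : m \in mpoly.msupp (mlpoly g) ->
    (mpoly.mdeg m <= d)%N = ~~ [forall i, m i != 0%N].
  move=> mS; have m1 := forallP (allP (mlpoly_multilinear g) m mS).
  rewrite mpoly.mdegE; apply/idP/idP => [md|].
    apply: contraL md => /forallP m0; rewrite -ltnNge -[leqLHS]card_ord -sum1_card.
    by apply: leq_sum => i _; rewrite lt0n.
  rewrite negb_forall => /existsP [i /negPn /eqP mi].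
  rewrite (bigD1 i) //= mi add0n.
  have cd : (#|predC1 i| = d)%N by rewrite cardC1 card_ord.
  rewrite -[leqRHS]cd.
  by rewrite -sum1_card; apply: leq_sum => j _; apply: m1.
rewrite sum_mlpoly; apply/deg_leP/eqP => [md|sum0 m mS].
  rewrite big_seq big1 // => m mS; have := full m mS.
  by rewrite md // => /esym /negbTE ->; rewrite mulr0.
rewrite full //; apply/negP => m0; move: sum0.
rewrite (bigD1_seq m) ?mpoly.msupp_uniq //= m0 mulr1 big1_seq ?addr0.
  by move/eqP; rewrite mpoly.mcoeff_eq0 mS.
(* Any other monomial with all exponents nonzero would equal m, since multilinearity forces all
   exponents of both to be 1. *)
move=> m' /andP [m'm m'S]; case: forallP => [m'0|_]; last by rewrite mulr0.
case/eqP: m'm; apply/mpoly.mnmP => i.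
have := forallP (allP (mlpoly_multilinear g) m mS) i.
have := forallP (allP (mlpoly_multilinear g) m' m'S) i.
by move: (m'0 i) (forallP m0 i); case: (m i) (m' i) => [|[|?]] [|[|?]].
Qed.

(** * Counting parametrizations of affine subspaces *)

Section Parametrizations.
Variables (k n : nat).
Implicit Types (M : 'M['F_2]_(k, n)) (v : 'rV['F_2]_n) (A : {set 'rV['F_2]_n}).

Lemma affine_map_inj v M : row_free M -> injective (affine_map v M).
Proof. by move=> fM u1 u2 /addrI; apply: row_free_inj. Qed.

Lemma parametrizes_comp v0 M0 A (a : 'rV['F_2]_k) (P : 'M['F_2]_k) :
  parametrizes v0 M0 A -> P \in unitmx ->
  parametrizes (v0 + a *m M0) (P *m M0) A.
Proof.
case/andP => fM0 /eqP -> uP; rewrite /parametrizes.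
rewrite -row_leq_rank mxrankMfree // mxrank_unit // leqnn /=; apply/eqP/setP => x.
apply/imsetP/imsetP => -[u _ ->].
  exists ((u - a) *m invmx P) => //; rewrite /affine_map mulmxA mulmxKV //.
  by rewrite mulmxBl -addrA [_ *m M0 + _]addrC subrK.
exists (a + u *m P) => //.
by rewrite /affine_map mulmxDl mulmxA addrA.
Qed.

(** The image of 0 gives a. The images of the basis vectors put the rows of M in the row space of
    M0, which gives P, and the full rank of M makes P invertible. *)
Lemma parametrizes_factor v0 M0 v M A :
  parametrizes v0 M0 A -> parametrizes v M A ->
  exists a P, [/\ P \in unitmx, v = v0 + a *m M0 & M = P *m M0].
Proof.
case/andP => fM0 /eqP -> /andP [fM /eqP eqA].
have inA u : exists w, v + u *m M = v0 + w *m M0.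
  have : affine_map v M u \in [set affine_map v0 M0 w | w : 'rV['F_2]_k].
    by rewrite eqA imset_f.
  by case/imsetP => w _ ?; exists w.
have [a va] := inA 0; rewrite mul0mx addr0 in va.
have /submxP [P MP] : (M <= M0)%MS.
  apply/row_subP => i; have [w] := inA (delta_mx 0 i).
  rewrite -rowE va -addrA => /addrI rM; apply/submxP; exists (w - a).
  by rewrite mulmxBl -rM addrAC subrr add0r.
exists a, P; split=> //.
rewrite -row_free_unit -row_leq_rank -[leqLHS](eqP fM) MP.
exact: mxrankM_maxl.
Qed.

(** Invertible affine changes of variables act simply transitively on the parametrizations of A. The
    count is thus the same for every A, so a uniform free pair (M, v) yields a uniform subspace. *)
Lemma card_parametrizations A : A \in affine_subspaces k n ->
  #|[set p : 'M['F_2]_(k, n) * 'rV['F_2]_n | parametrizes p.2 p.1 A]|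
  = #|[set q : 'M['F_2]_k * 'rV['F_2]_k | q.1 \in unitmx]|.
Proof.
rewrite inE => /existsP [v0 /existsP [M0 pA]].
have fM0 : row_free M0 by case/andP: pA.
rewrite -(@card_imset _ _ (fun q => (q.1 *m M0, v0 + q.2 *m M0))); last first.
  by move=> [P a] [P' a'] /= [/(row_free_inj fM0) -> /addrI /(row_free_inj fM0) ->].
congr #|pred_of_set _|; apply/setP => -[M v]; rewrite inE /=.
apply/idP/imsetP => [/(parametrizes_factor pA) [a [P [uP -> ->]]]|].
  by exists (P, a) => //; rewrite inE.
by case=> -[P a]; rewrite inE /= => uP [-> ->]; apply: parametrizes_comp.
Qed.

Definition affine_image (p : 'M['F_2]_(k, n) * 'rV['F_2]_n) : {set 'rV['F_2]_n} :=
  [set affine_map p.2 p.1 u | u : 'rV['F_2]_k].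

Lemma card_free_affine_image (Q : pred {set 'rV['F_2]_n}) :
  #|[set p | row_free p.1 && Q (affine_image p)]| =
  (#|[set A in affine_subspaces k n | Q A]| *
   #|[set q : 'M['F_2]_k * 'rV['F_2]_k | q.1 \in unitmx]|)%N.
Proof.
rewrite -sum_nat_const -sum1_card.
rewrite (partition_big affine_image (mem [set A in affine_subspaces k n | Q A])) /=.
  apply: eq_bigr => A; rewrite inE => /andP [/card_parametrizations <- QA].
  rewrite -sum1_card; apply: eq_bigl => p; rewrite !inE /parametrizes -andbA.
  congr (_ && _); rewrite eq_sym; case: eqP => [<-|]; last by rewrite andbF.
  by rewrite QA.
move=> p; rewrite !inE => /andP [fp ->]; rewrite andbT.
by apply/existsP; exists p.2; apply/existsP; exists p.1; rewrite /parametrizes fp eqxx.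
Qed.

End Parametrizations.

Lemma sum_affine_image (k n : nat) (p : 'M['F_2]_(k, n) * 'rV['F_2]_n)
    (f : 'rV['F_2]_n -> 'F_2) :
  row_free p.1 -> \sum_(x in affine_image p) f x = \sum_u f (affine_map p.2 p.1 u).
Proof.
move=> fp; rewrite big_imset /= => [|u1 u2 _ _]; last exact: affine_map_inj.
by apply: eq_bigl => u; rewrite inE.
Qed.

(** Rejection provides some parametrization on which the sum is nonzero. The sum depends only on the
    image set, so it is also nonzero for p. *)
Lemma gn_rejects_sum (d n : nat) (f : 'rV['F_2]_n -> 'F_2)
    (p : 'M['F_2]_(d.+1, n) * 'rV['F_2]_n) :
  row_free p.1 -> ~~ gn_accepts d f (affine_image p) ->
  \sum_u f (affine_map p.2 p.1 u) != 0.
Proof.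
move=> fp; rewrite -sum_affine_image // => /forallPn [v /forallPn [M]].
rewrite negb_imply deg_leq_sum0 => /andP [/andP [fM /eqP ->]].
by rewrite -(sum_affine_image (p := (M, v))).
Qed.

(** * From the subspace test to random cubes *)

Lemma mean_bool (R : numFieldType) (T : finType) (P : pred T) :
  mean (fun x => (P x)%:R) = #|[set x | P x]|%:R / #|T|%:R :> R.
Proof.
rewrite /mean -natr_sum -sum1_card; congr (_%:R / _).
by rewrite [RHS]big_mkcond; apply: eq_bigr => x _; rewrite inE; case: (P x).
Qed.

Lemma mean_const (R : numFieldType) (T : finType) (c : R) (x0 : T) :
  mean (fun _ : T => c) = c.
Proof.
rewrite /mean sumr_const -[_ *+ #|_|]mulr_natr mulfK // pnatr_eq0 -lt0n.
by apply/card_gt0P; exists x0.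
Qed.

Lemma mean_fst (R : numFieldType) (T1 T2 : finType) (y0 : T2) (F : T1 -> R) :
  mean (fun p : T1 * T2 => F p.1) = mean F.
Proof.
by rewrite -(mean_pair (fun x _ => F x)); apply: eq_mean => x; rewrite mean_const.
Qed.

(** Only cubes with free M are kept on the right. Conditioned on being free, they are distributed as
    the subspace picked by the test. *)
Lemma free_gn_reject_le (R : realFieldType) (d n : nat) (f : 'rV['F_2]_n -> 'F_2) :
  mean (fun M : 'M['F_2]_(d.+1, n) => (row_free M)%:R) * gn_reject_prob R d f
  <= mean (fun p : 'M['F_2]_(d.+1, n) * 'rV['F_2]_n =>
       (\sum_u f (affine_map p.2 p.1 u) != 0)%:R).
Proof.
rewrite -(mean_fst (0 : 'rV['F_2]_n)).
apply: (@le_trans _ _ (mean (fun p : 'M['F_2]_(d.+1, n) * 'rV['F_2]_n =>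
    (row_free p.1 && ~~ gn_accepts d f (affine_image p))%:R))); last first.
  apply: le_mean => p; rewrite ler_nat; case: andP => // -[fp rp].
  by rewrite gn_rejects_sum.
rewrite !mean_bool /= (card_free_affine_image _ (fun A => ~~ gn_accepts d f A)).
have := @card_free_affine_image d.+1 n xpredT.
have -> : [set A in affine_subspaces d.+1 n | true] = affine_subspaces d.+1 n.
  by apply/setP => A; rewrite inE andbT.
have -> : [set p : 'M['F_2]_(d.+1, n) * 'rV['F_2]_n | row_free p.1 && true]
    = [set p | row_free p.1] by apply/setP => p; rewrite !inE andbT.
move=> ->; rewrite /gn_reject_prob /prob !natrM.
(* If there is no subspace of dimension d + 1, the left side is 0. *)
have [->|S0] := posnP #|affine_subspaces d.+1 n|.
  by rewrite !mul0r divr_ge0 ?mulr_ge0 ?ler0n.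
rewrite le_eqVlt; apply/orP; left; apply/eqP.
have S0' : #|affine_subspaces d.+1 n|%:R != 0 :> R by rewrite pnatr_eq0 -lt0n.
by set T := (X in _ / X * _); set Ti := T^-1; field.
Qed.

(** * Rank of random matrices over F_2 *)

Lemma mean_sum (R : numFieldType) (I T : finType) (P : pred I) (F : I -> T -> R) :
  mean (fun x => \sum_(i | P i) F i x) = \sum_(i | P i) mean (F i).
Proof. by rewrite /mean exchange_big -mulr_suml. Qed.

(** Translating M by [pinvmx u *m w] shifts [u *m M] by w, so all values of [u *m M] are equally
    likely. *)
Lemma mean_mulmx_eq0 (R : numFieldType) (K : finFieldType) (k n : nat)
    (u : 'rV[K]_k) :
  u != 0 -> mean (fun M : 'M[K]_(k, n) => (u *m M == 0)%:R) = (#|K| ^ n)%:R^-1 :> R.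
Proof.
move=> u0; set q := mean _.
have fu : row_free u by rewrite /row_free rank_rV u0.
have qE w : q = mean (fun M : 'M[K]_(k, n) => (u *m M == w)%:R).
  rewrite [RHS](mean_bij _ (addr_bij (pinvmx u *m w))); apply: eq_mean => M /=.
  by rewrite mulmxDr mulmxA mulmxVp // mul1mx -[w + _ == w]subr_eq0 addrAC subrr add0r.
have : mean (fun M : 'M[K]_(k, n) => \sum_w (u *m M == w)%:R) = 1 :> R.
  rewrite -[RHS](@mean_const _ 'M[K]_(k, n) _ 0); apply: eq_mean => M.
  rewrite (bigD1 (u *m M)) //= eqxx big1 ?addr0 // => w wM.
  by rewrite eq_sym (negbTE wM).
rewrite mean_sum; under eq_bigr do rewrite -qE.
rewrite sumr_const -[_ *+ #|_|]mulr_natr.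
have -> : #|'rV[K]_n| = (#|K| ^ n)%N by rewrite card_mx mul1n.
have n0 : (#|K| ^ n)%:R != 0 :> R.
  by rewrite pnatr_eq0 -lt0n expn_gt0; apply/orP; left; apply/card_gt0P; exists 0.
by move=> q1; apply: (mulIf n0); rewrite q1 mulVf.
Qed.

Lemma card_F2 : #|'F_2| = 2%N.
Proof. exact: card_Fp. Qed.

(* Union bound over the nonzero vectors [u] with [u *m M = 0]. *)
Lemma mean_row_free_ge (R : realFieldType) (k n : nat) :
  1 - 2 ^+ k / 2 ^+ n <=
  mean (fun M : 'M['F_2]_(k, n) => (row_free M)%:R) :> R.
Proof.
have bound (M : 'M['F_2]_(k, n)) :
    1 - \sum_(u : 'rV['F_2]_k | u != 0) (u *m M == 0)%:R <= (row_free M)%:R :> R.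
  have [fM|nfM] := boolP (row_free M).
    by rewrite gerBl sumr_ge0.
  have : kermx M != 0 by rewrite kermx_eq0.
  case/rowV0Pn => u /sub_kermxP uM u0.
  rewrite (bigD1 u) //= uM eqxx /= opprD addrA subrr add0r oppr_le0.
  by rewrite sumr_ge0.
apply: le_trans (le_mean bound).
have -> : mean (fun M : 'M['F_2]_(k, n) =>
    1 - \sum_(u : 'rV['F_2]_k | u != 0) (u *m M == 0)%:R) =
    1 - mean (fun M : 'M['F_2]_(k, n) =>
          \sum_(u : 'rV['F_2]_k | u != 0) (u *m M == 0)%:R) :> R.
  by rewrite {1}/mean sumrB mulrBl; congr (_ - _); apply: (mean_const _ 0).
rewrite mean_sum (eq_bigr (fun=> (2 ^+ n)^-1)) => [|u u0]; last first.
  by rewrite mean_mulmx_eq0 // card_F2 natrX.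
rewrite lerD2l lerN2 sumr_const -[_ *+ #|_|]mulr_natl ler_wpM2r ?invr_ge0 ?exprn_ge0 //.
rewrite -natrX ler_nat (leq_trans (max_card _)) //.
by rewrite card_mx mul1n card_F2.
Qed.

(** The extra term [(2 ^+ k.+2)^-1] carries the induction: with x = 2^-k the step is (1/4 + x/4)(1 -
    x/4) >= 1/4 + x/8, which amounts to x <= 1. *)
Lemma prod_1_sub_pow2_ge (R : realFieldType) (k : nat) :
  1 / 4 + (2 ^+ k.+2)^-1 <= \prod_(1 <= i < k.+2) (1 - (2 ^+ i)^-1) :> R.
Proof.
elim: k => [|k IHk].
  by rewrite big_nat1 expr1; lra.
rewrite big_nat_recr //=; move: (\prod_(1 <= i < k.+2) _) IHk => P IHk.
have y1 : 1 <= 2 ^+ k :> R by rewrite exprn_ege1 // ler1n.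
have y0 : 2 ^+ k != 0 :> R by rewrite expf_neq0 ?pnatr_eq0.
rewrite (exprS _ k.+2) !(exprS _ k.+1) !(exprS _ k) in IHk *.
move: (2 ^+ k) y0 y1 IHk => y y0 y1 IHk.
set x := y^-1.
have x0 : 0 < x by rewrite invr_gt0; lra.
have x1 : x <= 1 by rewrite invf_le1 //; lra.
have -> : (2 * (2 * (2 * y)))^-1 = x / 8 by rewrite /x; field.
have ex2 : (2 * (2 * y))^-1 = x / 4 by rewrite /x; field.
rewrite ex2 in IHk *.
apply: le_trans (_ : (1 / 4 + x / 4) * (1 - x / 4) <= _); first by nra.
by rewrite ler_wpM2r //; lra.
Qed.

Lemma mean_unitmx_ge (R : realFieldType) (k : nat) :
  1 / 4 <= mean (fun M : 'M['F_2]_k.+1 => (row_free M)%:R) :> R.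
Proof.
rewrite mean_bool.
have -> : #|[set M : 'M['F_2]_k.+1 | row_free M]| = #|('GL_k.+1['F_2])%g|.
  by rewrite cardsT /= card_sub; apply: eq_card => A; rewrite inE row_free_unit.
rewrite card_GL // card_mx card_F2.
(* Taking 2^i out of each factor 2^i - 1 leaves the power of 2 with exponent k(k+1)/2 + (k+1)(k+2)/2
   = (k+1)^2, the number of matrices. *)
suff -> : (2 ^ 'C(k.+1, 2) * \prod_(1 <= i < k.+2) (2 ^ i - 1))%:R =
    (2 ^ (k.+1 * k.+1))%:R * \prod_(1 <= i < k.+2) (1 - (2 ^+ i)^-1) :> R.
  rewrite mulrAC mulfV ?mul1r ?pnatr_eq0 ?expn_eq0 //.
  apply: le_trans _ (prod_1_sub_pow2_ge _ _).
  by rewrite mul1r lerDl invr_ge0 exprn_ge0.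
elim: k => [|k IHk]; first by rewrite !big_nat1 bin_small // !muln1 !expn1 expr1; field.
rewrite (@big_nat_recr _ _ _ k.+2 1) // [in RHS](@big_nat_recr _ _ _ k.+2 1) //=.
move: (\prod_(1 <= i < k.+2) _)%N (\prod_(1 <= i < k.+2) _) IHk => P Q IHk.
rewrite binS bin1 expnD mulnACA natrM IHk.
have -> : (k.+2 * k.+2 = k.+1 * k.+1 + (k.+1 + k.+2))%N by ring.
rewrite [in RHS]expnD !natrM natrB ?expn_gt0 // expnD natrM !natrX.
by field; rewrite expf_neq0 ?pnatr_eq0.
Qed.

(** * Distance to low degree *)

Lemma prob_setT (R : numFieldType) (T : finType) (P : pred T) :
  prob R [set: T] P = mean (fun x => (P x)%:R).
Proof.
rewrite mean_bool /prob cardsT; congr (_%:R / _).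
by apply: eq_card => x; rewrite !inE.
Qed.

Lemma eq_deg (n : nat) (f g : 'rV['F_2]_n -> 'F_2) : f =1 g -> deg f = deg g.
Proof.
move=> fg; rewrite /deg /mlpoly.
by under eq_bigr do rewrite fg.
Qed.

Lemma delta_le (R : realFieldType) (d n : nat) (f g : 'rV['F_2]_n -> 'F_2) :
  (deg g <= d)%N -> delta R d f <= mean (fun x => (f x != g x)%:R).
Proof.
move=> dg; pose h : {ffun 'rV['F_2]_n -> 'F_2} := finfun g.
have hE : h =1 g by move=> x; rewrite ffunE.
rewrite /delta; apply: (bigmin_inf h); first by rewrite (eq_deg hE).
rewrite prob_setT (@eq_mean _ _ _ (fun x => (f x != g x)%:R)) // => x.
by rewrite hE.
Qed.

(** The bound [b <= 1] covers the default value of the minimum in [delta]. *)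
Lemma le_delta (R : realFieldType) (d n : nat) (f : 'rV['F_2]_n -> 'F_2) (b : R) :
  b <= 1 -> (forall g, (deg g <= d)%N -> b <= mean (fun x => (f x != g x)%:R)) ->
  b <= delta R d f.
Proof.
move=> b1 bg; rewrite /delta; apply/bigmin_geP; split=> // g dg.
by rewrite prob_setT bg.
Qed.

Lemma delta_le0 (R : realFieldType) (d n : nat) (f : 'rV['F_2]_n -> 'F_2) :
  (deg f <= d)%N -> delta R d f <= 0.
Proof.
move/delta_le => /(_ R f) /le_trans; apply; rewrite /mean big1 ?mul0r // => x _.
by rewrite eqxx.
Qed.

Lemma mean_phase (R : numFieldType) (T : finType) (x0 : T) (f : T -> 'F_2) :
  mean (fun x => phase R (f x)) = 1 - 2 * mean (fun x => (f x != 0)%:R).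
Proof.
rewrite (eq_mean (fun x => phaseE R (f x))) -meanZ {1}/mean sumrB mulrBl.
by congr (_ - _); apply: mean_const x0.
Qed.

(** * Rejection by random cubes *)

Definition cube_reject_prob (R : numFieldType) (k n : nat)
    (f : 'rV['F_2]_n -> 'F_2) : R :=
  mean (fun p : 'M['F_2]_(k, n) * 'rV['F_2]_n =>
    (\sum_u f (affine_map p.2 p.1 u) != 0)%:R).

(** The product of phases over a cube is the phase of the sum of f over it, so the Gowers average is
    the bias of that sum. *)
Lemma gowers_cube_reject (R : numFieldType) (k n : nat) (f : 'rV['F_2]_n -> 'F_2) :
  gowers k (fun x => phase R (f x)) = 1 - 2 * cube_reject_prob R k f.
Proof.
rewrite gowers_cube mean_pair -mean_phase; last by exact: (0, 0).
by apply: eq_mean => p; rewrite phase_sum.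
Qed.

Lemma cube_reject_prob_ge0 (R : numFieldType) (k n : nat) (f : 'rV['F_2]_n -> 'F_2) :
  0 <= cube_reject_prob R k f.
Proof. by rewrite /cube_reject_prob /mean divr_ge0 ?ler0n // sumr_ge0. Qed.

Lemma cube_reject_prob_le1 (R : numFieldType) (k n : nat) (f : 'rV['F_2]_n -> 'F_2) :
  cube_reject_prob R k f <= 1.
Proof.
rewrite -[leRHS](@mean_const R ('M['F_2]_(k, n) * 'rV['F_2]_n)%type _ (0, 0)).
by apply: le_mean => p; case: (_ != 0).
Qed.

(** Changing f at a single point makes its sum zero, hence its degree at most d. *)
Lemma delta_point_le (R : realFieldType) (d : nat) (f : 'rV['F_2]_d.+1 -> 'F_2) :
  \sum_x f x != 0 -> delta R d f <= (2 ^+ d.+1)^-1.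
Proof.
move=> sf; pose g x := f x + (x == 0)%:R.
have dg : (deg g <= d)%N.
  rewrite deg_leq_sum0 big_split /=.
  have -> : \sum_(x : 'rV['F_2]_d.+1) (x == 0)%:R = 1 :> 'F_2.
    by rewrite (bigD1 0) //= eqxx big1 ?addr0 // => x /negbTE ->.
  by case: (F2_cases (\sum_x f x)) sf => ->; rewrite ?eqxx.
apply: le_trans (delta_le R f dg) _; rewrite mean_bool card_mx mul1n card_F2 natrX.
have -> : [set x | f x != g x] = [set 0].
  apply/setP => x; rewrite !inE /g -[X in X != _]addr0 (inj_eq (addrI _)).
  by case: (x == 0).
by rewrite cards1 mul1r.
Qed.

(** A free cube here runs through the whole space, so it always rejects; at least 1/4 of the square
    matrices are free. *)
Lemma cube_reject_prob_full (R : realFieldType) (d : nat)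
    (f : 'rV['F_2]_d.+1 -> 'F_2) :
  \sum_x f x != 0 -> 1 / 4 <= cube_reject_prob R d.+1 f.
Proof.
move=> sf; apply: le_trans (mean_unitmx_ge R d) _.
rewrite -(mean_fst (0 : 'rV['F_2]_d.+1)); apply: le_mean => -[M v] /=.
have [fM|_] := boolP (row_free M); last by rewrite ler0n.
have -> : \sum_u f (affine_map v M u) = \sum_x f x; last by rewrite sf.
rewrite [RHS](reindex (affine_map v M)) //.
by apply: onW_bij; apply: injF_bij; apply: affine_map_inj.
Qed.

(* For [n = d + 1] only about 0.29 of the parametrizations are free, but then the
   test is deterministic and [delta R d f <= 2 ^- n] makes up for it. *)
Lemma cube_reject_prob_ge (R : realFieldType) (d n : nat)
    (f : 'rV['F_2]_n -> 'F_2) (m : R) :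
  m <= 2 ^+ d / 4 * delta R d f ->
  ((d < n)%N -> 4 * m <= gn_reject_prob R d f) ->
  2 * m <= cube_reject_prob R d.+1 f.
Proof.
move=> m_delta m_gn.
have e0 : 0 <= 2 ^+ d / 4 :> R by rewrite divr_ge0 ?exprn_ge0.
(* Here delta is at most 0, so m is too. *)
have small : (deg f <= d)%N -> 2 * m <= cube_reject_prob R d.+1 f.
  move=> /(delta_le0 R) d0; apply: le_trans (cube_reject_prob_ge0 _ _ _).
  have := le_trans m_delta (mulr_ge0_le0 e0 d0); lra.
have [nd|] := leqP n d; first by apply: small (leq_trans (deg_leq_dim f) nd).
rewrite leq_eqVlt => /orP [/eqP dn|dn].
  subst n; have [|nsmall] := boolP (deg f <= d)%N; first exact: small.
  rewrite deg_leq_sum0 in nsmall.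
  apply: le_trans _ (cube_reject_prob_full R nsmall).
  have := le_trans m_delta (ler_wpM2l e0 (delta_point_le R nsmall)).
  have y0 : 2 ^+ d != 0 :> R by rewrite expf_neq0 ?pnatr_eq0.
  (* m is at most (2^d / 4) / 2^(d+1) = 1/8, so 2 m <= 1/4. *)
  by rewrite exprS (_ : _ / 4 * _ = 1 / 8 :> R); [lra | field].
rewrite /cube_reject_prob; apply: le_trans _ (free_gn_reject_le R d f).
(* Now n >= d + 2, so the union bound gives a failure probability of at most 2^(d+1-n) <= 1/2. Half
   of the rejection probability 4 m remains. *)
have q_ge : 1 / 2 <= mean (fun M : 'M['F_2]_(d.+1, n) => (row_free M)%:R) :> R.
  apply: le_trans (mean_row_free_ge R d.+1 n).
  have : 2 ^+ d.+1 / 2 ^+ n <= 1 / 2 :> R.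
    rewrite ler_pdivrMr ?exprn_gt0 // -(subnKC dn) exprD [2 ^+ d.+2]exprS.
    rewrite mulrA mulrA mul1r mulVf ?mul1r ?pnatr_eq0 // ler_peMr ?exprn_ge0 //.
    by rewrite exprn_ege1 // ler1n.
  by lra.
have := m_gn (ltnW dn); have : 0 <= gn_reject_prob R d f.
  by rewrite /gn_reject_prob /prob divr_ge0 ?ler0n.
move: (mean _) (gn_reject_prob _ _ _) q_ge => q r q_ge r0 m4.
by have := ler_wpM2r r0 q_ge; lra.
Qed.

(** * Correlation of the XOR with low degree *)

Lemma F2_addr_eq0 (a b : 'F_2) : (a + b != 0) = (a != b).
Proof. by case: (F2_cases a) => ->; case: (F2_cases b) => ->. Qed.

Lemma xor_power_correlation (R : realFieldType) (d n t : nat)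
    (f : 'rV['F_2]_n -> 'F_2) (g : 'rV['F_2]_(t * n) -> 'F_2) :
  (deg g <= d)%N ->
  (1 - 2 * mean (fun x => (xor_power f x != g x)%:R)) ^+ (2 ^ d.+1)
  <= (1 - 2 * cube_reject_prob R d.+1 f) ^+ t.
Proof.
move=> dg; rewrite -gowers_cube_reject.
have -> : 1 - 2 * mean (fun x => (xor_power f x != g x)%:R) =
    mean (fun x => (\prod_(i < t) phase R (f (row i (vec_mx x)))) * phase R (g x)) :> R.
  transitivity (mean (fun x => phase R (xor_power f x + g x))).
    rewrite (mean_phase _ 0); congr (1 - 2 * _).
    by apply: eq_mean => x; rewrite F2_addr_eq0.
  by apply: eq_mean => x; rewrite phaseD phase_sum.
apply: le_trans (mean_exp_le_gowers _ _) _.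
rewrite gowers_phase; last exact: deg_derivs_vanish.
by rewrite (gowers_blocks _ (fun _ x => phase R (f x))) prodr_const card_ord.
Qed.

(** Extracts a root of order 2^(d+1). The argument is by contradiction because c may be negative:
    the negated conclusion makes c positive, and raising to the power is then strictly monotone. *)
Lemma le_pow_powR (R : realType) (a c : R) (d t : nat) :
  0 <= a -> c ^+ (2 ^ d.+1) <= (a ^+ 2) ^+ t -> c <= a `^ (t%:R / 2 ^+ d).
Proof.
move=> a0; rewrite -exprM => cK; rewrite leNgt; apply/negP => bc.
have b0 : 0 <= a `^ (t%:R / 2 ^+ d) by apply: powR_ge0.
have : (a `^ (t%:R / 2 ^+ d)) ^+ (2 ^ d.+1) < c ^+ (2 ^ d.+1).
  by rewrite ltrXn2r ?nnegrE ?expn_eq0 // (le_trans b0 (ltW bc)).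
rewrite ltNge -(powR_mulrn _ b0) -powRrM.
have -> : t%:R / 2 ^+ d * (2 ^ d.+1)%:R = (2 * t)%:R :> R.
  by rewrite natrX exprS natrM; field; rewrite expf_neq0 ?pnatr_eq0.
by rewrite powR_mulrn // cK.
Qed.

Theorem theorem4 (R : realType) (eps1 : R) (eps1_gt0 : 0 < eps1)
  (eps1P : forall (d n : nat) (h : 'rV['F_2]_n -> 'F_2), (d.+1 <= n)%N ->
     Num.min (2 ^+ d * delta R d h) eps1 <= gn_reject_prob R d h) :
  (forall (d n t : nat) (f : 'rV['F_2]_n -> 'F_2), (1 <= n)%N -> (1 <= t)%N ->
     (1 - (1 - 2 * Num.min (eps1 / 4) (2 ^ (d%:Z - 2) * delta R d f))
            `^ (t%:R / 2 ^+ d)) / 2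
     <= delta R d (xor_power (t := t) f)) /\
  (exists c : R, 0 < c /\
     forall (d n t : nat) (f : 'rV['F_2]_n -> 'F_2), (1 <= n)%N -> (1 <= t)%N ->
       1 / 10 <= delta R d f ->
       1 / 2 - 2 `^ (- (c * (t%:R / 2 ^+ d))) <= delta R d (xor_power (t := t) f)).
Proof.
have exp_sub2 d : 2 ^ (d%:Z - 2) = 2 ^+ d / 4 :> R.
  by rewrite expfzDr ?pnatr_eq0 //; congr (_ * _); rewrite -exprnN -natrX.
have reject d n (f : 'rV['F_2]_n -> 'F_2) :
    2 * Num.min (eps1 / 4) (2 ^ (d%:Z - 2) * delta R d f) <= cube_reject_prob R d.+1 f.
  rewrite exp_sub2; apply: cube_reject_prob_ge => [|dn].
    by rewrite ge_min lexx orbT.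
  apply: le_trans _ (eps1P d n f dn); rewrite le_min.
  set e := Num.min _ _.
  have e1 : e <= eps1 / 4 by rewrite ge_min lexx.
  have e2 : e <= 2 ^+ d / 4 * delta R d f by rewrite ge_min lexx orbT.
  by apply/andP; split; lra.
have main d n t (f : 'rV['F_2]_n -> 'F_2) :
    (1 - (1 - 2 * Num.min (eps1 / 4) (2 ^ (d%:Z - 2) * delta R d f))
      `^ (t%:R / 2 ^+ d)) / 2 <= delta R d (xor_power (t := t) f).
  move: (Num.min _ _) (reject d n f) => m m_le.
  have r1 := cube_reject_prob_le1 R d.+1 f.
  (* From 2 m <= rho <= 1, where rho is the cube rejection probability. *)
  have a0 : 0 <= 1 - 2 * m by lra.
  apply: le_delta => [|g dg].
    by have := powR_ge0 (1 - 2 * m) (t%:R / 2 ^+ d); lra.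
  have : 1 - 2 * mean (fun x => (xor_power f x != g x)%:R) <=
      (1 - 2 * m) `^ (t%:R / 2 ^+ d).
    apply: le_pow_powR a0 _; apply: le_trans (xor_power_correlation R f dg) _.
    have : 0 <= 1 - 2 * cube_reject_prob R d.+1 f.
      by rewrite -gowers_cube_reject gowersS_ge0.
    (* 1 - 2 rho <= 1 - 4 m <= (1 - 2 m)^2. *)
    have : 1 - 2 * cube_reject_prob R d.+1 f <= (1 - 2 * m) ^+ 2 by nra.
    move=> h1 h0; rewrite lerXn2r ?nnegrE //; exact: le_trans h1.
  by lra.
split=> [d n t f _ _|]; first exact: main.
(* 1/40 is the value of 2^(d-2) / 10 at d = 0, its minimum over d. Thus m0 bounds every m from below
   and depends on [eps1] only. *)
pose m0 := Num.min (eps1 / 4) (1 / 40).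
have m0_gt0 : 0 < m0 by rewrite lt_min; apply/andP; split; lra.
have m0_le : m0 <= 1 / 40 by rewrite ge_min lexx orbT.
have b0 : 0 < 1 - 2 * m0 by lra.
have ln2 : 0 < ln (2 : R) by rewrite ln_gt0 // ltr1n.
(* c is minus the base-2 logarithm of 1 - 2 m0, so that 2^(-c s) = (1 - 2 m0)^s. *)
exists (- (ln (1 - 2 * m0) / ln 2)); split.
  by rewrite -mulNr divr_gt0 // oppr_gt0 ln_lt0 //; apply/andP; split; lra.
move=> d n t f _ _ f_ge; set s := t%:R / 2 ^+ d.
have s0 : 0 <= s by rewrite divr_ge0 ?exprn_ge0.
have -> : 2 `^ (- (- (ln (1 - 2 * m0) / ln 2) * s)) = (1 - 2 * m0) `^ s.
  rewrite /powR pnatr_eq0 /= (gt_eqF b0); congr expR.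
  by field; rewrite gt_eqF.
apply: le_trans (main d n t f); rewrite -/s.
have m0_m : m0 <= Num.min (eps1 / 4) (2 ^ (d%:Z - 2) * delta R d f).
  rewrite le_min ge_min lexx /= exp_sub2; apply: le_trans m0_le _.
  have : 1 <= 2 ^+ d :> R by rewrite exprn_ege1 // ler1n.
  by nra.
move: (reject d n f) (cube_reject_prob_le1 R d.+1 f).
move: (Num.min _ (_ * delta R d f)) m0_m => m m0_m mr r1.
have : (1 - 2 * m) `^ s <= (1 - 2 * m0) `^ s.
  by rewrite ge0_ler_powR ?nnegrE //; lra.
(* With B = (1 - 2 m0)^s >= 0, the factor 1/2 is dropped by 1/2 - B <= (1 - B)/2. *)
have := powR_ge0 (1 - 2 * m0) s.
by lra.
Qed.
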